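(* Let $\mathscr{H}$ be a complex Hilbert space with $\dim\mathscr{H}=\infty$ and let $T\in\mathbb{B}(\mathscr{H})$. Suppose that $\mathbb{S}_{\mathscr{H}_0}=\mathbb{M}_T$, where $\mathscr{H}_0$ is a finite dimensional subspace of $\mathscr{H}$, and that $$\|T\|_{\mathscr{H}_0^\perp}=\sup\{\|T\xi\|:\ \xi\in\mathscr{H}_0^\perp,\ \|\xi\|=1\}<\|T\|.$$ Then for every $S\in\mathbb{B}(\mathscr{H})$ the following statements are equivalent: (i) $T\perp^s_B S$. (ii) There exists a unit vector $\xi\in\mathscr{H}_0$ such that $\|T\xi\|=\|T\|$ and $S^*T\xi=0$. (iii) There exists a unit vector $\xi\in\mathscr{H}_0$ such that $\|T\|\xi=|T|\xi$ and $S^*T\xi=0$.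
   Context: $\mathbb{B}(\mathscr{H})$ is the algebra of bounded linear operators on $\mathscr{H}$ with the operator norm, and $|T|=(T^*T)^{1/2}$. $\mathbb{S}_{\mathscr{H}_0}$ is the set of unit vectors of $\mathscr{H}_0$, and $\mathbb{M}_T=\{\xi\in\mathscr{H}:\|\xi\|=1,\ \|T\xi\|=\|T\|\}$ is the norm attaining set of $T$. Strong Birkhoff--James orthogonality (with $\mathbb{B}(\mathscr{H})$ regarded as a Hilbert $C^*$-module over itself): $T\perp^s_B S$ means $\|T+SA\|\ge\|T\|$ for all $A\in\mathbb{B}(\mathscr{H})$. *)

(* Defs.v *)
From HB Require Import structures.
From mathcomp Require Import all_boot all_order all_algebra.
From mathcomp Require Import complex.
From mathcomp Require Import boolp classical_sets functions reals.
From mathcomp Require Import topology normedtype.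

Set Implicit Arguments.
Unset Strict Implicit.
Unset Printing Implicit Defensive.

Import Order.TTheory GRing.Theory Num.Theory.
Import numFieldNormedType.Exports.

Local Open Scope classical_set_scope.
Local Open Scope ring_scope.
Local Open Scope complex_scope.

(* Complex Hilbert spaces: the scalar field is R[i] for R the real numbers, and
   the norm (hence the complete topology) is the one given by the inner product.
   The inner product is linear in its first argument and conjugate-linear in
   the second one. *)
HB.mixin Record CompleteNormedModule_isHilbert (R : realType) H
    & CompleteNormedModule R[i] H := {
  hdot : {dot H for (@Num.conj R[i])} ;
  hdot_normE : forall x : H, `|x| ^+ 2 = hdot x x
}.

#[short(type="hilbertType")]
HB.structure Definition Hilbert (R : realType) :=
  {H of CompleteNormedModule R[i] H & CompleteNormedModule_isHilbert R H}.

Section Hilbert_operators.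
Variables (R : realType) (H : hilbertType R).
Implicit Types (A : set H) (f : H -> H) (T S : {linear H -> H}).

Definition hinner (x y : H) : R[i] := hdot x y.

(* The library norm `|x| lives in R[i] and is a nonnegative real there;
   hnorm x is the same number as an element of R. *)
Definition hnorm (x : H) : R := complex.Re `|x|.

Definition lin_span n (e : 'I_n -> H) : set H :=
  [set x | exists c : 'I_n -> R[i], x = \sum_(i < n) c i *: e i].

Definition fin_dim_subspace A : Prop :=
  exists n (e : 'I_n -> H), A = lin_span e.

Definition ortho_compl A : set H :=
  [set x | forall y, A y -> hinner x y = 0].

Definition unit_sphere A : set H := [set x | A x /\ hnorm x = 1].

Definition bounded_op f : Prop :=
  exists M : R, forall x, hnorm (f x) <= M * hnorm x.

Definition opnorm_on A f : R := sup [set hnorm (f x) | x in unit_sphere A].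

Definition opnorm f : R := opnorm_on [set: H] f.

Definition norm_attaining f : set H :=
  [set x | hnorm x = 1 /\ hnorm (f x) = opnorm f].

(* adjoint f y is the vector z such that <f x, y> = <x, z> for all x; it exists
   (Riesz) when f is linear and bounded, and it is unique. *)
Definition adjoint f : H -> H := fun y =>
  xget 0 [set z | forall x, hinner (f x) y = hinner x z].

Definition positive_op f : Prop := forall x, 0 <= hinner (f x) x.

(* The positive square root of f, which exists and is unique when f is a
   bounded positive operator. *)
Definition sqrt_op f : H -> H :=
  xget (cst 0) [set P : H -> H |
    [/\ linear P, bounded_op P, positive_op P & P \o P = f]].

Definition abs_op f : H -> H := sqrt_op (adjoint f \o f).

Definition strong_BJ_orth T S : Prop :=
  forall A : {linear H -> H}, bounded_op A ->
    opnorm T <= opnorm (T \+ (S \o A)).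

End Hilbert_operators.

(* Main.v *)
From HB Require Import structures.
Require Import Defs.
From mathcomp Require Import all_boot all_order all_algebra.
From mathcomp Require Import complex.
From mathcomp Require Import boolp classical_sets functions reals.
From mathcomp Require Import topology normedtype.
From mathcomp Require Import ring lra.

Import Order.TTheory GRing.Theory Num.Theory.
Import numFieldNormedType.Exports.
Local Open Scope classical_set_scope.
Local Open Scope ring_scope.
Local Open Scope complex_scope.

Set Implicit Arguments.
Unset Strict Implicit.
Unset Printing Implicit Defensive.

(** Write t for the norm of T and b < t for its norm on the orthogonal
    complement of H0.

    (i) implies (ii). If no unit vector of H0 is killed by S^* T, then S^* T is
    injective on the finite-dimensional space H0, so c |x| <= |S^* T x| there
    for some c > 0 ([lin_span_bounded_below]). Perturb T by SA with
    A = - eps S^* T. If eps |S|^2 <= 1, then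
    |T z - eps S S^* T z|^2 <= |T z|^2 - eps |S^* T z|^2 ([perturbation_le]).
    Split z = x + y with x in H0 and y orthogonal to H0. As T^* T x = t^2 x
    ([norm_attained_eigen]), the vectors T x and T y are orthogonal, so
    |T z|^2 <= t^2 |x|^2 + b^2 |y|^2; the term - eps |S^* T z|^2 makes the
    coefficient of |x|^2 smaller than t^2, at the cost of adding a multiple of
    eps to the coefficient of |y|^2, where there is room because b < t. So the
    perturbed operator has norm less than t ([not_strong_BJ_orth]).

    (ii) implies (iii). If |T x| = t |x| then |T|^2 x = T^* T x = t^2 x, hence
    u = |T| x - t x satisfies |T| u = - t u, and u = 0 because |T| is positive.
    This needs |T| to exist ([abs_opP]): 1 - T^* T / K^2 is a self-adjoint
    contraction B for K >= t, and Y = (B + Y^2) / 2 is solved by iterating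
    from 0; the successive differences are dominated in norm by those of the
    scalar iteration for B = 1, which is increasing and bounded by 1. Then
    |T| = K (1 - Y).

    (iii) implies (i). A unit vector x of H0 satisfies |T x| = t by hypothesis,
    and if S^* T x = 0 then <(T + SA) x, T x> = t^2, so that
    |(T + SA) x| >= t by Cauchy-Schwarz.

    Adjoints exist by the Riesz representation theorem ([riesz_real]), proved
    by minimizing |z|^2 - 2 phi z. *)

(** * The real inner product *)

Section RealInnerProduct.
Variables (R : realType) (H : hilbertType R).
Implicit Types (x y z : H) (a : R[i]) (c : R).

Lemma hinnerDl x y z : hinner (x + y) z = hinner x z + hinner y z.
Proof. exact: linearDl. Qed.

Lemma hinnerZl a x y : hinner (a *: x) y = a * hinner x y.
Proof. exact: linearZl_LR. Qed.

Lemma hinnerC x y : hinner y x = (hinner x y)^*.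
Proof. by rewrite /hinner hermC expr0 mul1r. Qed.

Lemma hinnerE x : hinner x x = `|x| ^+ 2.
Proof. by rewrite hdot_normE. Qed.

Lemma hinnerDr x y z : hinner z (x + y) = hinner z x + hinner z y.
Proof. by rewrite !(hinnerC _ z) hinnerDl rmorphD. Qed.

Lemma hinnerZr (a : R[i]) x y : hinner y (a *: x) = a^* * hinner y x.
Proof. by rewrite !(hinnerC _ y) hinnerZl rmorphM. Qed.

Lemma hinnerNl x y : hinner (- x) y = - hinner x y.
Proof. by rewrite -scaleN1r hinnerZl mulN1r. Qed.

Lemma hinner_eq0 x : hinner x x = 0 -> x = 0.
Proof. by move/eqP; rewrite hinnerE sqrf_eq0 normr_eq0 => /eqP. Qed.

Lemma hnormE x : `|x| = (hnorm x)%:C.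
Proof. by rewrite /hnorm RRe_real // normr_real. Qed.

(** The real part of the inner product: a symmetric real bilinear form with
    the same norm. Identities between vectors can be tested against it
    ([rinner_inj]), which turns them into identities in R. *)
Definition rinner x y : R := complex.Re (hinner x y).

Lemma rinnerC x y : rinner x y = rinner y x.
Proof. by rewrite /rinner (hinnerC x y); case: (hinner x y). Qed.

Lemma rinnerDl x y z : rinner (x + y) z = rinner x z + rinner y z.
Proof. by rewrite /rinner hinnerDl raddfD. Qed.

Lemma rinnerZl c x y : rinner (c%:C *: x) y = c * rinner x y.
Proof. by rewrite /rinner hinnerZl; case: (hinner x y) => u v /=; ring. Qed.

Lemma rinner0l x : rinner 0 x = 0.
Proof. by rewrite -(scale0r x) -(rmorph0 (real_complex R)) rinnerZl mul0r. Qed.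

Lemma rinnerNl x y : rinner (- x) y = - rinner x y.
Proof. by rewrite -scaleN1r -(rmorphN1 (real_complex R)) rinnerZl mulN1r. Qed.

Lemma rinnerDr x y z : rinner z (x + y) = rinner z x + rinner z y.
Proof. by rewrite !(rinnerC z) rinnerDl. Qed.

Lemma rinnerZr c x y : rinner y (c%:C *: x) = c * rinner y x.
Proof. by rewrite !(rinnerC y) rinnerZl. Qed.

Lemma rinnerNr x y : rinner y (- x) = - rinner y x.
Proof. by rewrite !(rinnerC y) rinnerNl. Qed.

Definition rinner_linE :=
  (rinnerDl, rinnerDr, rinnerNl, rinnerNr, rinnerZl, rinnerZr).

Lemma rinnerxx x : rinner x x = hnorm x ^+ 2.
Proof. by rewrite /rinner hinnerE hnormE -rmorphXn. Qed.

Lemma Im_hinner x y : complex.Im (hinner x y) = rinner x ('i *: y).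
Proof.
rewrite /rinner (hinnerC ('i *: y)) hinnerZl (hinnerC x).
by case: (hinner x y) => u v /=; ring.
Qed.

Lemma rinner_iC x y : rinner ('i *: x) y = - rinner x ('i *: y).
Proof.
rewrite -Im_hinner /rinner hinnerZl.
by case: (hinner x y) => u v /=; ring.
Qed.

(** The complex inner product is determined by the real one. *)
Lemma hinner_ext x y x' y' : rinner x y = rinner x' y' ->
  rinner x ('i *: y) = rinner x' ('i *: y') -> hinner x y = hinner x' y'.
Proof.
rewrite -!Im_hinner /rinner.
by case: (hinner x y) => u v; case: (hinner x' y') => u' v' /= -> ->.
Qed.

Lemma hnorm_ge0 x : 0 <= hnorm x.
Proof. by rewrite -ler0c -hnormE. Qed.

Lemma hnorm_eq0 x : hnorm x = 0 -> x = 0.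
Proof. by move=> x0; apply/normr0_eq0; rewrite hnormE x0. Qed.

Lemma hnorm0 : hnorm (0 : H) = 0.
Proof. by rewrite /hnorm normr0. Qed.

Lemma hnorm_opp x : hnorm (- x) = hnorm x.
Proof. by rewrite /hnorm normrN. Qed.

Lemma hnorm_distC x y : hnorm (x - y) = hnorm (y - x).
Proof. by rewrite /hnorm distrC. Qed.

Lemma ler_hnormD x y : hnorm (x + y) <= hnorm x + hnorm y.
Proof. by rewrite -lecR rmorphD /= -!hnormE ler_normD. Qed.

Lemma hnormZ a x : hnorm (a *: x) = complex.Re `|a| * hnorm x.
Proof.
apply: (@complexI R).
by rewrite rmorphM /= -(hnormE x) -(hnormE (a *: x)) normrZ.
Qed.

Lemma hnormZr c x : hnorm (c%:C *: x) = `|c| * hnorm x.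
Proof. by rewrite hnormZ normc_def /= expr0n addr0 sqrtr_sqr. Qed.

Lemma hnormD_sqr x y :
  hnorm (x + y) ^+ 2 = hnorm x ^+ 2 + 2 * rinner x y + hnorm y ^+ 2.
Proof. by rewrite -!rinnerxx !rinner_linE (rinnerC y x); ring. Qed.

Lemma hnormB_sqr x y :
  hnorm (x - y) ^+ 2 = hnorm x ^+ 2 - 2 * rinner x y + hnorm y ^+ 2.
Proof. by rewrite -!rinnerxx !rinner_linE (rinnerC y x); ring. Qed.

Lemma ortho_sqr x y : rinner x y = 0 ->
  hnorm (x + y) ^+ 2 = hnorm x ^+ 2 + hnorm y ^+ 2.
Proof. by move=> xy; rewrite hnormD_sqr xy mulr0 addr0. Qed.

(** Expand the square of |v| u - |u| v. *)
Lemma cauchy_schwarz x y : `|rinner x y| <= hnorm x * hnorm y.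
Proof.
suff le1 u v : rinner u v <= hnorm u * hnorm v.
  by rewrite ler_norml le1 andbT lerNl -rinnerNl -(hnorm_opp x) le1.
have [u0|u0] := eqVneq (hnorm u) 0.
  rewrite (hnorm_eq0 u0) hnorm0 mul0r.
  by rewrite rinner0l.
have [v0|v0] := eqVneq (hnorm v) 0.
  rewrite (hnorm_eq0 v0) hnorm0 mulr0.
  by rewrite rinnerC rinner0l.
have {}u0 : 0 < hnorm u by rewrite lt_def u0 hnorm_ge0.
have {}v0 : 0 < hnorm v by rewrite lt_def v0 hnorm_ge0.
have := sqr_ge0 (hnorm ((hnorm v)%:C *: u - (hnorm u)%:C *: v)).
rewrite hnormB_sqr !hnormZr !rinner_linE !ger0_norm ?hnorm_ge0 // => h.
rewrite -(ler_pM2l (mulr_gt0 u0 v0)); nra.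
Qed.

Lemma rinner_le x y : rinner x y <= hnorm x * hnorm y.
Proof. exact: le_trans (ler_norm _) (cauchy_schwarz x y). Qed.

Lemma rinner_inj x y : (forall z, rinner z x = rinner z y) -> x = y.
Proof.
move=> xy; apply/eqP; rewrite -subr_eq0; apply/eqP/hnorm_eq0.
apply/eqP; rewrite -sqrf_eq0 -rinnerxx rinnerDr rinnerNr xy; apply/eqP; ring.
Qed.

(** Completeness, with real tolerances. *)
Lemma hilbert_complete (u : nat -> H) :
    (forall e : R, 0 < e ->
       exists N, forall n, (N <= n)%N -> hnorm (u n - u N) <= e) ->
  exists l, forall e : R, 0 < e ->
    exists N, forall n, (N <= n)%N -> hnorm (u n - l) <= e.
Proof.
move=> uC.
have cvu : cvg (u @ \oo).
  apply/cauchy_cvgP/cauchyP => e e0.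
  have e0' : 0 < complex.Re e by move: e0; rewrite ltcE => /andP[].
  have eE : e = (complex.Re e)%:C by rewrite RRe_real // gtr0_real.
  have [N uN] := uC (complex.Re e / 2) (divr_gt0 e0' (ltr0n _ 2)).
  exists (u N); exists N => // n /= Nn.
  rewrite -ball_normE /ball_ /= hnormE hnorm_distC eE ltcR.
  by apply: le_lt_trans (uN n Nn) _; lra.
exists (lim (u @ \oo)) => e e0.
have /cvgrPdist_le /(_ e%:C) := cvu.
rewrite ltcR => /(_ e0)[N _ uN].
by exists N => n Nn; have := uN n Nn; rewrite hnormE lecR hnorm_distC.
Qed.

End RealInnerProduct.

(** * Riesz representation and adjoints *)

Section Riesz.
Variables (R : realType) (H : hilbertType R).
Implicit Types (x y z : H) (a : R[i]) (c : R).

Lemma small_natSinv (e : R) : 0 < e ->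
  exists N, forall n, (N <= n)%N -> n.+1%:R^-1 <= e.
Proof.
move=> e0; exists (Num.truncn e^-1) => n Nn.
rewrite -[leRHS]invrK lef_pV2 ?posrE ?invr_gt0 ?ltr0n //.
apply/ltW/(lt_le_trans (truncnS_gt _)).
by rewrite ler_nat.
Qed.

(** Riesz representation of a real-linear bounded functional. A minimizing
    sequence for J z = |z|^2 - 2 phi z is Cauchy by the parallelogram law, and
    its limit represents phi by varying J in a direction h. *)
Lemma riesz_real (phi : H -> R) (M : R) :
    {morph phi : x y / x + y} -> (forall c x, phi (c%:C *: x) = c * phi x) ->
    (forall x, phi x <= M * hnorm x) ->
  exists z, forall x, phi x = rinner x z.
Proof.
move=> phiD phiZ phiM.
pose J z := hnorm z ^+ 2 - 2 * phi z.
have infJ : has_inf (range J).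
  split; first by exists (J 0), 0.
  exists (- M ^+ 2) => _ [z _ <-]; rewrite /J.
  by have := phiM z; have := sqr_ge0 (hnorm z - M); nra.
pose d := inf (range J).
have dJ z : d <= J z by apply: ge_inf; [exact: infJ.2 | exists z].
have Jnear e : 0 < e -> exists z, J z < d + e.
  by move=> /(inf_adherent)/(_ infJ)[_ [z _ <-] ?]; exists z.
have parallel z w : hnorm (z - w) ^+ 2 <= 2 * (J z + J w) - 4 * d.
  have := dJ ((2^-1 : R)%:C *: (z + w)).
  rewrite {1}/J phiZ phiD hnormZr exprMn hnormB_sqr hnormD_sqr /J.
  rewrite ger0_norm ?invr_ge0 //; lra.
have [u uJ] : exists u, forall n, J (u n) < d + n.+1%:R^-1.
  have {}Jnear n : exists z, J z < d + n.+1%:R^-1.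
    by apply: Jnear; rewrite invr_gt0 ltr0Sn.
  by have [u ?] := choice Jnear; exists u.
have [|z uz] := @hilbert_complete _ _ u.
  move=> e e0; have [|N HN] := @small_natSinv (e ^+ 2 / 4).
    by rewrite divr_gt0 // exprn_gt0.
  exists N => n Nn; rewrite -ler_sqr ?nnegrE ?hnorm_ge0 ?(ltW e0) //.
  apply: le_trans (parallel _ _) _.
  have := uJ n; have := uJ N; have := HN n Nn; have := HN N (leqnn N).
  move: (n.+1%:R^-1) (N.+1%:R^-1) => i j; lra.
exists z => h; rewrite rinnerC.
have variation w e : J w < d + e ->
    (rinner w h - phi h) ^+ 2 <= (1 + hnorm h ^+ 2) * e.
  set a := _ - _; set k := 1 + _ => Jw.
  have k0 : 0 < k by rewrite ltr_pwDl ?sqr_ge0.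
  (* the minimum along h is at - a / |h|^2; the added 1 avoids dividing by 0 *)
  have := dJ (w + (- a / k)%:C *: h).
  rewrite /J phiD phiZ hnormD_sqr rinnerZr hnormZr exprMn.
  rewrite real_normK ?num_real //.
  set b := - a / k.
  have ab : a = - b * k by rewrite /b !mulNr opprK divfK ?gt_eqF.
  move: Jw; rewrite /J.
  have -> : phi h = rinner w h - a by rewrite /a; ring.
  have -> : hnorm h ^+ 2 = k - 1 by rewrite /k; ring.
  rewrite ab => ? ?; have ? := sqr_ge0 b.
  rewrite exprMn sqrrN.
  have -> : b ^+ 2 * k ^+ 2 = k * (b ^+ 2 * k) by ring.
  rewrite ler_pM2l //; nra.
apply/eqP; rewrite eq_sym -subr_eq0; apply/negPn/negP => b0.
set b := rinner z h - phi h in b0.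
(* b^2 <= C e^2 for every e > 0, in particular when C e = |b| *)
pose C := 2 * hnorm h ^+ 2 + 2 * (1 + hnorm h ^+ 2).
have C2 : 2 <= C by rewrite /C; have := sqr_ge0 (hnorm h); lra.
have [e e0 eC] : exists2 e : R, 0 < e & C * e = `|b|.
  have C0 : 0 < C by lra.
  exists (`|b| / C); first by rewrite divr_gt0 // normr_gt0.
  by rewrite mulrC divfK // gt_eqF.
have [N1 HN1] := uz e e0.
have [N2 HN2] := small_natSinv (exprn_gt0 2 e0).
pose n := maxn N1 N2.
have un : hnorm (u n - z) <= e by apply: HN1; exact: leq_maxl.
have Jn : J (u n) < d + e ^+ 2.
  by apply: lt_le_trans (uJ n) _; rewrite lerD2l HN2 // leq_maxr.
have := variation _ _ Jn; set a := _ - _ => a2.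
have bE : b = a - rinner (u n - z) h by rewrite !rinner_linE /a /b; ring.
have c2 : rinner (u n - z) h ^+ 2 <= e ^+ 2 * hnorm h ^+ 2.
  rewrite -exprMn -(real_normK (num_real (rinner _ _))) ler_sqr ?nnegrE //;
    last by rewrite mulr_ge0 ?hnorm_ge0 ?(ltW e0).
  by apply: le_trans (cauchy_schwarz _ _) _; rewrite ler_wpM2r ?hnorm_ge0.
have b2 : b ^+ 2 <= C * e ^+ 2.
  have aux (p q r s : R) : p ^+ 2 <= (1 + s ^+ 2) * r ^+ 2 ->
      q ^+ 2 <= r ^+ 2 * s ^+ 2 ->
      (p - q) ^+ 2 <= (2 * s ^+ 2 + 2 * (1 + s ^+ 2)) * r ^+ 2.
    by have := sqr_ge0 (p + q); nra.
  by rewrite bE; apply: aux.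
have b2E : b ^+ 2 = (C * e) ^+ 2 by rewrite eC real_normK ?num_real.
have e2 : 0 < e ^+ 2 by rewrite exprn_gt0.
move: b2; rewrite b2E exprMn ler_pM2r // => ?; nra.
Qed.

End Riesz.

Section Adjoint.
Variables (R : realType) (H : hilbertType R).
Implicit Types (x y z : H) (a : R[i]) (c : R) (T : {linear H -> H}).

Lemma bounded_opP (f : H -> H) : bounded_op f ->
  exists2 M : R, 0 <= M & forall x, hnorm (f x) <= M * hnorm x.
Proof.
move=> [M fM]; exists `|M|; first exact: normr_ge0.
by move=> x; apply: le_trans (fM x) _; rewrite ler_wpM2r ?hnorm_ge0 ?ler_norm.
Qed.

(** The vector chosen by [adjoint] exists. *)
Lemma adjointP T : bounded_op T ->
  forall x y, hinner (T x) y = hinner x (adjoint T y).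
Proof.
move=> bT x y; suff [z Tz] : exists z, forall x, hinner (T x) y = hinner x z.
  rewrite (@xgetPex _ 0 [set z | forall x, hinner (T x) y = hinner x z]) //.
  by exists z.
have [M M0 TM] := bounded_opP bT.
have [|||z Tz] := @riesz_real _ _ (fun x => rinner (T x) y) (M * hnorm y).
- by move=> v w; rewrite linearD rinnerDl.
- by move=> c v; rewrite linearZ rinnerZl.
- move=> v; apply: le_trans (rinner_le _ _) _.
  by rewrite mulrAC ler_wpM2r ?hnorm_ge0.
exists z => v; apply: hinner_ext; first exact: Tz.
by apply: oppr_inj; rewrite -!rinner_iC -linearZ Tz.
Qed.

Lemma rinner_adjoint T : bounded_op T ->
  forall x y, rinner (T x) y = rinner x (adjoint T y).
Proof. by move=> bT x y; rewrite /rinner adjointP. Qed.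

Lemma adjoint_linear T : bounded_op T -> linear (adjoint T).
Proof.
move=> bT a x y; apply: rinner_inj => z.
rewrite /rinner -adjointP // (hinnerC _ (T z)) (hinnerC _ z).
rewrite !hinnerDl !hinnerZl !(hinnerC (T z)) !(hinnerC z) !adjointP //.
Qed.

Lemma adjoint_le T (M : R) : bounded_op T ->
  (forall x, hnorm (T x) <= M * hnorm x) ->
  forall x, hnorm (adjoint T x) <= M * hnorm x.
Proof.
move=> bT TM x; have [->|x0] := eqVneq (hnorm (adjoint T x)) 0.
  exact: le_trans (hnorm_ge0 _) (TM x).
have {}x0 : 0 < hnorm (adjoint T x) by rewrite lt_def x0 hnorm_ge0.
rewrite -(ler_pM2l x0) -expr2 -rinnerxx -rinner_adjoint //.
apply: le_trans (rinner_le _ _) _; rewrite mulrA (mulrC _ M).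
by rewrite ler_wpM2r ?hnorm_ge0.
Qed.

End Adjoint.

(** * Square roots *)

Lemma le0_small (R : realType) (b C : R) :
  (forall e, 0 < e -> b <= e * C) -> b <= 0.
Proof.
move=> bC; rewrite leNgt; apply/negP => b0.
have k0 : 0 < 1 + `|C| by rewrite ltr_pwDl.
have := bC (b / (1 + `|C|)) (divr_gt0 b0 k0).
rewrite mulrAC ler_pdivlMr // ler_pM2l // leNgt => /negP[].
by apply: le_lt_trans (ler_norm C) _; rewrite ltrDr.
Qed.

(** For a self-adjoint contraction B, the equation 2 Z = B + Z^2 has a solution
    Z, also a self-adjoint contraction; then (1 - Z)^2 = 1 - B. *)
Section ContractionSqrt.
Variables (R : realType) (H : hilbertType R) (B : H -> H).
Hypothesis B_lin : linear B.
Hypothesis B_sym : forall x y, rinner (B x) y = rinner x (B y).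
Hypothesis B_le1 : forall x, hnorm (B x) <= hnorm x.

Local Notation half := ((2^-1 : R)%:C).

(** Iterates, from 0, of Y |-> (B + Y^2) / 2. *)
Fixpoint sqrt_iter n : H -> H :=
  if n is m.+1 then fun x => half *: (B x + sqrt_iter m (sqrt_iter m x))
  else fun=> 0.

(** The same iteration for the scalar B = 1: it bounds the norms of the
    operator iterates and of their differences. *)
Fixpoint sqrt_iter_bound n : R :=
  if n is m.+1 then 2^-1 * (1 + sqrt_iter_bound m ^+ 2) else 0.

Local Notation Y := sqrt_iter.
Local Notation r := sqrt_iter_bound.

Lemma sqrt_iter_linear n : linear (Y n).
Proof.
elim: n => [|n IHn] a x y /=; first by rewrite scaler0 addr0.
rewrite B_lin !IHn !scalerDr !scalerA (mulrC a) !addrA.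
by congr (_ + _); rewrite addrAC.
Qed.

Lemma sqrt_iterB n x y : Y n (x - y) = Y n x - Y n y.
Proof.
by have := sqrt_iter_linear n (-1) y x; rewrite !scaleN1r !(addrC (- _)).
Qed.

Lemma sqrt_iter_sym n x y : rinner (Y n x) y = rinner x (Y n y).
Proof.
elim: n x y => [|n IHn] x y /=; first by rewrite rinner0l rinnerC rinner0l.
by rewrite !rinner_linE B_sym !IHn.
Qed.

Lemma sqrt_iter_bound_itv n : 0 <= r n <= 1.
Proof. by elim: n => [|n /andP[r0 r1]] /=; [lra|apply/andP; split; nra]. Qed.

Lemma sqrt_iter_bound_homo n m : (n <= m)%N -> r n <= r m.
Proof.
move=> /subnK <-; elim: (m - n)%N => // k; rewrite addSn => /le_trans; apply.
by rewrite /=; move: (r _) => s; have := sqr_ge0 (1 - s); lra.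
Qed.

Lemma sqrt_iter_le n x : hnorm (Y n x) <= r n * hnorm x.
Proof.
elim: n x => [|n IHn] x /=; first by rewrite hnorm0 mul0r.
rewrite hnormZr ger0_norm ?invr_ge0 // -mulrA ler_pM2l ?invr_gt0 //.
apply: le_trans (ler_hnormD _ _) _; rewrite mulrDl mul1r lerD //.
apply: le_trans (IHn _) _; rewrite expr2 -mulrA ler_wpM2l //.
by case/andP: (sqrt_iter_bound_itv n).
Qed.

(** By induction, writing Y'^2 - Y^2 = Y' (Y' - Y) + (Y' - Y) Y. *)
Lemma sqrt_iter_step n x :
  hnorm (Y n.+1 x - Y n x) <= (r n.+1 - r n) * hnorm x.
Proof.
elim: n x => [|n IHn] x.
  rewrite /= addr0 subr0 hnormZr ger0_norm ?invr_ge0 // expr0n /= addr0 mulr1.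
  by rewrite subr0 ler_pM2l ?invr_gt0.
have -> : Y n.+2 x - Y n.+1 x = half *:
    (Y n.+1 (Y n.+1 x - Y n x) + (Y n.+1 (Y n x) - Y n (Y n x))).
  rewrite sqrt_iterB addrA subrK.
  rewrite -[Y n.+2 x]/(half *: (B x + Y n.+1 (Y n.+1 x))).
  rewrite -[in X in _ - X]/(half *: (B x + Y n (Y n x))).
  by rewrite -scalerBr opprD addrACA subrr add0r.
rewrite hnormZr ger0_norm ?invr_ge0 //.
apply: le_trans (_ : 2^-1 * ((r n.+1 * ((r n.+1 - r n) * hnorm x)) +
                     (r n.+1 - r n) * (r n * hnorm x)) <= _); last first.
  have -> : r n.+2 = 2^-1 * (1 + r n.+1 ^+ 2) by [].
  rewrite [leLHS](_ : _ = 2^-1 * (r n.+1 ^+ 2 - r n ^+ 2) * hnorm x);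
    last by ring.
  have -> : r n ^+ 2 = 2 * r n.+1 - 1 by rewrite /=; field.
  by rewrite le_eqVlt; apply/orP; left; apply/eqP; field.
have /andP[r0 _] := sqrt_iter_bound_itv n.+1.
have d0 : 0 <= r n.+1 - r n by rewrite subr_ge0 sqrt_iter_bound_homo.
rewrite ler_pM2l ?invr_gt0 //; apply: le_trans (ler_hnormD _ _) _; apply: lerD.
  by apply: le_trans (sqrt_iter_le _ _) _; rewrite ler_wpM2l.
by apply: le_trans (IHn _) _; rewrite ler_wpM2l // sqrt_iter_le.
Qed.

Lemma sqrt_iter_dist n m x : (n <= m)%N ->
  hnorm (Y m x - Y n x) <= (r m - r n) * hnorm x.
Proof.
move=> /subnK <-; elim: (m - n)%N => [|k IHk].
  by rewrite !subrr mul0r hnorm0.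
rewrite addSn -(subrK (Y (k + n) x) (Y (k + n).+1 x)) -addrA.
apply: le_trans (ler_hnormD _ _) (le_trans (lerD (sqrt_iter_step _ _) IHk) _).
by rewrite -mulrDl addrA subrK.
Qed.

Lemma sqrt_iter_cauchy e : 0 < e -> exists N, forall n x, (N <= n)%N ->
  hnorm (Y n x - Y N x) <= e * hnorm x.
Proof.
move=> e0; have r_sup : has_sup (range r).
  split; first by exists (r 0%N), 0%N.
  by exists 1 => _ [n _ <-]; case/andP: (sqrt_iter_bound_itv n).
have [_ [N _ <-] rN] := sup_adherent e0 r_sup.
exists N => n x Nn; apply: le_trans (sqrt_iter_dist x Nn) _.
rewrite ler_wpM2r ?hnorm_ge0 // lerBlDr.
have : r n <= sup (range r) by apply: ub_le_sup; [exact: r_sup.2|exists n].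
by move=> ?; lra.
Qed.

(** The iterates converge in operator norm. *)
Lemma sqrt_iter_lim : exists Z : H -> H, forall e, 0 < e ->
  exists N, forall n x, (N <= n)%N -> hnorm (Y n x - Z x) <= e * hnorm x.
Proof.
have cvgY x : exists l, forall e : R, 0 < e ->
    exists N, forall n, (N <= n)%N -> hnorm (Y n x - l) <= e.
  apply: hilbert_complete => e e0.
  have k0 : 0 < hnorm x + 1 by rewrite ltr_wpDl ?hnorm_ge0.
  have [N HN] := sqrt_iter_cauchy (divr_gt0 e0 k0).
  exists N => n /HN /le_trans; apply.
  by rewrite mulrAC ler_pdivrMr // ler_pM2l // lerDl.
have [Z YZ] := choice cvgY; exists Z => e e0.
have [N HN] := sqrt_iter_cauchy (divr_gt0 e0 (ltr0Sn R 1)).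
exists N => n x Nn.
rewrite -subr_le0; apply: (@le0_small _ _ 1) => e' e'0.
have [N' HN'] := YZ x e' e'0.
pose k := maxn N N'.
have h1 := HN' k (leq_maxr _ _).
have h2 := HN k x (leq_maxl _ _).
have h3 := HN n x Nn.
have := ler_hnormD (Y n x - Y N x) (Y N x - Z x); rewrite addrA subrK => h4.
have := ler_hnormD (Y N x - Y k x) (Y k x - Z x).
rewrite addrA subrK (hnorm_distC (Y N x)) => h5.
by move: h1 h2 h3 h4 h5; rewrite -/k; lra.
Qed.

Lemma contraction_sqrt : exists Z : H -> H,
  [/\ linear Z, forall x y, rinner (Z x) y = rinner x (Z y),
      forall x, hnorm (Z x) <= hnorm x
    & forall x, Z x + Z x = B x + Z (Z x)].
Proof.
have [Z YZ] := sqrt_iter_lim.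
have Ynear (e : R) : 0 < e ->
    exists n, forall x, hnorm (Y n x - Z x) <= e * hnorm x.
  by move=> /YZ[n Yn]; exists n => x; apply: Yn.
have Zle x : hnorm (Z x) <= hnorm x.
  rewrite -subr_le0; apply: (@le0_small _ _ (hnorm x)) => e /Ynear[n /(_ x)].
  have /andP[_ r1] := sqrt_iter_bound_itv n.
  have := ler_hnormD (Y n x) (Z x - Y n x); rewrite addrC subrK hnorm_distC.
  by have := sqrt_iter_le n x; have := hnorm_ge0 x; nra.
have eq0 (v : H) (C : R) : (forall e : R, 0 < e -> hnorm v <= e * C) -> v = 0.
  by move=> vC; apply/hnorm_eq0/le_anti; rewrite (le0_small vC) hnorm_ge0.
exists Z; split=> //.
- move=> a x y; apply: subr0_eq.
  apply: (eq0 _ (hnorm (a *: x + y) + complex.Re `|a| * hnorm x + hnorm y)).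
  move=> e /Ynear[n Yn].
  have -> : Z (a *: x + y) - (a *: Z x + Z y) =
    - (Y n (a *: x + y) - Z (a *: x + y)) + a *: (Y n x - Z x) + (Y n y - Z y).
    rewrite sqrt_iter_linear scalerBr !opprD !opprK.
    by apply: rinner_inj => w; rewrite !rinner_linE; ring.
  apply: le_trans (ler_hnormD _ _) _; rewrite !mulrDr lerD //.
  apply: le_trans (ler_hnormD _ _) _; rewrite hnorm_opp hnormZ lerD //.
  by rewrite mulrCA ler_wpM2l // -ler0c RRe_real ?normr_real.
- move=> x y; apply/eqP; rewrite -subr_eq0 -normr_le0.
  apply: (@le0_small _ _ (2 * hnorm x * hnorm y)) => e /Ynear[n Yn].
  have -> : rinner (Z x) y - rinner x (Z y) =
    rinner x (Y n y - Z y) - rinner (Y n x - Z x) y.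
    by rewrite !rinner_linE sqrt_iter_sym; ring.
  apply: le_trans (ler_normB _ _) _.
  have := cauchy_schwarz x (Y n y - Z y).
  have := cauchy_schwarz (Y n x - Z x) y.
  have := Yn x; have := Yn y; have := hnorm_ge0 x; have := hnorm_ge0 y; nra.
- move=> x; apply: subr0_eq.
  apply: (eq0 _ (4 * hnorm x)) => e e0; have [n Yn] := YZ e e0.
  have Y1 := Yn n.+1 x (leqnSn n); have Y0 := Yn n x (leqnn n).
  have Y2 := Yn n (Z x) (leqnn n).
  have Y3 : hnorm (Y n (Y n x - Z x)) <= e * hnorm x.
    apply: le_trans (sqrt_iter_le _ _) _; apply: le_trans Y0.
    by rewrite ler_piMl ?hnorm_ge0 //; case/andP: (sqrt_iter_bound_itv n).
  have -> : Z x + Z x - (B x + Z (Z x)) =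
    - ((Y n.+1 x - Z x) + (Y n.+1 x - Z x))
    + (Y n (Y n x - Z x) + (Y n (Z x) - Z (Z x))).
    have -> : B x = Y n.+1 x + Y n.+1 x - Y n (Y n x).
      rewrite /= -scalerDl -rmorphD /= (_ : 2^-1 + 2^-1 = 1); last by lra.
      by rewrite scale1r addrK.
    by rewrite sqrt_iterB; apply: rinner_inj => w; rewrite !rinner_linE; ring.
  apply: le_trans (ler_hnormD _ _) _; rewrite hnorm_opp.
  have := ler_hnormD (Y n.+1 x - Z x) (Y n.+1 x - Z x).
  have := ler_hnormD (Y n (Y n x - Z x)) (Y n (Z x) - Z (Z x)).
  move: Y2; have := Zle x; have := hnorm_ge0 x.
  by move: Y1 Y3; nra.
Qed.
End ContractionSqrt.

Section AbsOp.
Variables (R : realType) (H : hilbertType R).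
Implicit Types (x y z : H) (T : {linear H -> H}).

(** Self-adjointness makes the quadratic form real. *)
Lemma positive_sym (P : H -> H) :
  (forall x y, rinner (P x) y = rinner x (P y)) -> linear P ->
  (forall x, 0 <= rinner (P x) x) -> positive_op P.
Proof.
move=> Psym Plin Ppos x; rewrite lecE /= Ppos andbT.
have PZ a y : P (a *: y) = a *: P y.
  have P0 : P 0 = 0.
    by have := Plin (-1) 0 0; rewrite scaler0 addr0 scaleN1r addNr.
  by have := Plin a y 0; rewrite P0 !addr0.
have := Psym x ('i *: x); rewrite PZ (rinnerC x) rinner_iC -Im_hinner => h.
by apply/eqP; lra.
Qed.

(** The square root chosen by [abs_op] exists. *)
Lemma abs_opP T : bounded_op T ->
  [/\ linear (abs_op T), bounded_op (abs_op T), positive_op (abs_op T)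
    & abs_op T \o abs_op T = adjoint T \o T].
Proof.
move=> bT; suff [P sqrtP] : exists P : H -> H,
  [/\ linear P, bounded_op P, positive_op P & P \o P = adjoint T \o T].
  by apply: (@xgetPex _ (cst 0) [set P : H -> H |
    [/\ linear P, bounded_op P, positive_op P & P \o P = adjoint T \o T]]);
    exists P.
have [M M0 TM] := bounded_opP bT.
pose K := M + 1; have K0 : 0 < K by rewrite ltr_wpDl.
have TK x : hnorm (T x) <= K * hnorm x.
  by apply: le_trans (TM x) _; rewrite ler_wpM2r ?hnorm_ge0 // lerDl.
pose G x := adjoint T (T x).
have G_lin : linear G.
  by move=> a x y; rewrite /G linearP adjoint_linear.
have G_inner x y : rinner (G x) y = rinner (T x) (T y).
  by rewrite rinnerC -rinner_adjoint // rinnerC.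
pose B x := x - (K ^- 2)%:C *: G x.
have [||| Z [Z_lin Z_sym Z_le ZE]] := @contraction_sqrt _ _ B.
- move=> a x y; rewrite /B G_lin !scalerDr !scalerN !scalerA (mulrC _ a) opprD.
  by rewrite addrACA.
- move=> x y; rewrite /B !rinner_linE G_inner (rinnerC x (G y)) G_inner.
  by rewrite (rinnerC (T y)).
- move=> x; rewrite -ler_sqr ?nnegrE ?hnorm_ge0 //.
  rewrite /B hnormB_sqr rinnerZr (rinnerC x) G_inner rinnerxx hnormZr exprMn.
  rewrite real_normK ?num_real //.
  have GK : hnorm (G x) ^+ 2 <= K ^+ 2 * hnorm (T x) ^+ 2.
    rewrite -exprMn ler_sqr ?nnegrE ?mulr_ge0 ?hnorm_ge0 ?(ltW K0) //.
    exact: adjoint_le.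
  have K2 : 0 < K ^- 2 by rewrite invr_gt0 exprn_gt0.
  have : K ^- 2 ^+ 2 * hnorm (G x) ^+ 2 <= K ^- 2 * hnorm (T x) ^+ 2.
    rewrite expr2 -mulrA ler_pM2l // -(ler_pM2l (exprn_gt0 2 K0)) mulrA.
    by rewrite divff ?mul1r // expf_neq0 // gt_eqF.
  have := sqr_ge0 (hnorm (T x)); nra.
pose P x := K%:C *: (x - Z x).
have P_lin : linear P.
  move=> a x y; rewrite /P Z_lin !scalerDr !scalerN !scalerDr !scalerA.
  by rewrite (mulrC _ a) opprD addrACA.
have P_sym x y : rinner (P x) y = rinner x (P y).
  by rewrite /P !rinner_linE Z_sym.
exists P; split=> //.
- exists (K * 2) => x; rewrite /P hnormZr gtr0_norm // -mulrA ler_pM2l //.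
  apply: le_trans (ler_hnormD _ _) _; rewrite hnorm_opp.
  by have := Z_le x; lra.
- apply: positive_sym => // x; rewrite /P rinnerZl mulr_ge0 ?(ltW K0) //.
  rewrite !rinner_linE rinnerxx subr_ge0 (le_trans (rinner_le _ _)) //.
  by rewrite expr2 ler_wpM2r ?hnorm_ge0.
- apply/funext => x /=; rewrite -/(G x).
  have ZZ : Z (x - Z x) = Z x - Z (Z x).
    by have := Z_lin (-1) (Z x) x; rewrite !scaleN1r !(addrC (- _)).
  have ZK : Z (P x) = K%:C *: Z (x - Z x).
    have Z0 : Z 0 = 0.
      by have := Z_lin (-1) 0 0; rewrite scaler0 addr0 scaleN1r addNr.
    by have := Z_lin K%:C (x - Z x) 0; rewrite Z0 !addr0.
  rewrite {1}/P ZK ZZ /P -scalerBr scalerA.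
  have -> : x - Z x - (Z x - Z (Z x)) = (K ^- 2)%:C *: G x.
    have := ZE x; rewrite /B => ZE'.
    have -> : (K ^- 2)%:C *: G x = x + Z (Z x) - (Z x + Z x).
      by rewrite ZE'; apply: rinner_inj => w; rewrite !rinner_linE; ring.
    by apply: rinner_inj => w; rewrite !rinner_linE; ring.
  rewrite scalerA -!rmorphM /= -expr2 divff ?scale1r //.
  by rewrite expf_neq0 // gt_eqF.
Qed.

End AbsOp.

(** * Finite-dimensional subspaces *)

Section FiniteDim.
Variables (R : realType) (H : hilbertType R).
Implicit Types (x y z : H).

(** A function with a proof of linearity, as a bundled linear map. *)
Definition linear_pack (f : H -> H) (f_lin : linear f) : {linear H -> H} :=
  HB.pack f (GRing.isLinear.Build _ _ _ _ f f_lin).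

Lemma lin_span_comb n (e : 'I_n -> H) (a : R[i]) x y :
  lin_span e x -> lin_span e y -> lin_span e (a *: x + y).
Proof.
move=> [c ->] [d ->]; exists (fun i => a * c i + d i).
rewrite scaler_sumr -big_split; apply: eq_bigr => i _ /=.
by rewrite scalerDl scalerA.
Qed.

Lemma lin_span0 n (e : 'I_n -> H) : lin_span e 0.
Proof.
by exists (fun=> 0); rewrite big1 // => i _; rewrite scale0r.
Qed.

Lemma lin_spanZ n (e : 'I_n -> H) (a : R[i]) x :
  lin_span e x -> lin_span e (a *: x).
Proof.
by move=> ex; rewrite -[_ *: _]addr0; apply: lin_span_comb (lin_span0 e).
Qed.

Lemma lin_spanS n (e : 'I_n.+1 -> H) x : lin_span e x <->
  exists y a, lin_span (fun i => e (widen_ord (leqnSn n) i)) y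
              /\ x = y + a *: e ord_max.
Proof.
split=> [[c ->]|[_ [a [[c ->] ->]]]].
  pose w := widen_ord (leqnSn n).
  rewrite big_ord_recr /=.
  exists (\sum_(i < n) c (w i) *: e (w i)), (c ord_max).
  by split=> //; eexists.
exists (fun i => if unlift ord_max i is Some j then c j else a).
rewrite big_ord_recr /= unlift_none; congr (_ + _).
apply: eq_bigr => i _; congr (_ *: _).
have -> : widen_ord (leqnSn n) i = lift ord_max i.
  by apply: val_inj; exact: esym (lift_max i).
by rewrite liftK.
Qed.

(** Orthogonal decomposition, by induction on the number of generators as in
    the Gram-Schmidt process. *)
Lemma lin_span_proj n (e : 'I_n -> H) z : exists x y,
  [/\ lin_span e x, ortho_compl (lin_span e) y & z = x + y].
Proof.
elim: n e z => [|n IHn] e z.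
  exists 0, z; rewrite add0r; split=> //; first exact: lin_span0.
  by move=> _ [c ->]; rewrite big_ord0 hinnerC /hinner linear0l rmorph0.
set e' := fun i => e (widen_ord (leqnSn n) i).
have [u [w [e'u e'w uw]]] := IHn e' (e ord_max).
have [x [y [e'x e'y ->]]] := IHn e' z.
(* when w = 0, any value of c will do *)
pose c := hinner y w / hinner w w.
exists (x + c *: w), (y - c *: w); split.
- apply/lin_spanS; exists (- c *: u + x), c; split; first exact: lin_span_comb.
  by rewrite uw scalerDr scaleNr addrACA addNr add0r.
- move=> _ /lin_spanS[v [a [e'v ->]]].
  have ortho s : lin_span e' s -> hinner (y - c *: w) s = 0.
    by move=> e's; rewrite hinnerDl hinnerNl hinnerZl e'y // e'w // mulr0 subr0.
  rewrite hinnerDr ortho // hinnerZr uw hinnerDr ortho // !add0r.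
  rewrite hinnerDl hinnerNl hinnerZl /c.
  have [/hinner_eq0 ->|w0] := eqVneq (hinner w w) 0.
    by rewrite /hinner !linear0r mulr0 subr0 mulr0.
  by rewrite divfK // subrr mulr0.
- by rewrite addrACA subrr addr0.
Qed.

(** The generators need not be independent: some family of coefficients is
    controlled by the norm. *)
Lemma lin_span_coef n (e : 'I_n -> H) : exists2 C : R, 0 <= C &
  forall x, lin_span e x -> exists2 c : 'I_n -> R[i],
    x = \sum_(i < n) c i *: e i &
    forall i, complex.Re `|c i| <= C * hnorm x.
Proof.
elim: n e => [|n IHn] e; first by exists 0 => // x [c ->]; exists c => // -[].
set e' := fun i => e (widen_ord (leqnSn n) i).
have [C C0 eC] := IHn e'.
have [u [w [e'u e'w uw]]] := lin_span_proj e' (e ord_max).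
(* the coefficient of the last generator is read off its component w
   orthogonal to the others, or can be taken to be 0 when w = 0 *)
have [K [K0 eK]] : exists K : R, 0 <= K /\ forall x, lin_span e x ->
  exists y a, [/\ lin_span e' y, x = y + a *: e ord_max &
                  complex.Re `|a| <= K * hnorm x].
  have [w0|w0] := eqVneq w 0.
    exists 0; split=> // x /lin_spanS[y [a [e'y ->]]].
    exists (a *: u + y), 0; split; first exact: lin_span_comb.
      by rewrite uw w0 addr0 scale0r addr0 addrC.
    by rewrite normr0 mul0r.
  have {}w0 : 0 < hnorm w.
    by rewrite lt_def hnorm_ge0 andbT; apply: contra_neq w0 => /hnorm_eq0.
  exists (hnorm w)^-1; split; first by rewrite invr_ge0 ltW.
  move=> x /lin_spanS[y [a [e'y xE]]]; exists y, a; split=> //.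
  rewrite mulrC ler_pdivlMr // -hnormZ -ler_sqr ?nnegrE ?hnorm_ge0 //.
  have -> : x = (a *: u + y) + a *: w.
    by rewrite xE uw scalerDr addrA (addrC y).
  rewrite ortho_sqr ?lerDr ?sqr_ge0 // rinnerC /rinner hinnerZl e'w ?mulr0 //.
  exact: lin_span_comb.
exists (C * (1 + K * hnorm (e ord_max)) + K).
  by rewrite addr_ge0 ?mulr_ge0 ?addr_ge0 ?mulr_ge0 ?hnorm_ge0.
move=> x /eK[y [a [e'y xE aK]]].
have [c yE cC] := eC y e'y.
exists (fun i => if unlift ord_max i is Some j then c j else a).
  rewrite big_ord_recr /= unlift_none xE yE; congr (_ + _).
  apply: eq_bigr => i _; congr (_ *: _).
  have -> : widen_ord (leqnSn n) i = lift ord_max i.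
    by apply: val_inj; exact: esym (lift_max i).
  by rewrite liftK.
have y_le : hnorm y <= (1 + K * hnorm (e ord_max)) * hnorm x.
  have -> : y = x - a *: e ord_max by rewrite xE addrK.
  apply: le_trans (ler_hnormD _ _) _; rewrite hnorm_opp hnormZ.
  have := hnorm_ge0 (e ord_max); nra.
move=> i; case: unliftP => [j _|_].
  apply: le_trans (cC j) _.
  have := hnorm_ge0 x; nra.
apply: le_trans aK _; rewrite mulrDl lerDr.
by rewrite !mulr_ge0 ?addr_ge0 ?mulr_ge0 ?hnorm_ge0.
Qed.

Lemma hnorm_sum n (f : 'I_n -> H) :
  hnorm (\sum_(i < n) f i) <= \sum_(i < n) hnorm (f i).
Proof.
elim/big_ind2 : _ => [|x s y t xs yt|i _] //; first by rewrite hnorm0.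
exact: le_trans (ler_hnormD _ _) (lerD xs yt).
Qed.

(** Apply [lin_span_coef] to the images of the generators: x is then the
    combination of the generators with the coefficients found for L x. *)
Lemma lin_span_bounded_below n (e : 'I_n -> H) (L : {linear H -> H}) :
  (forall x, lin_span e x -> L x = 0 -> x = 0) ->
  exists2 c : R, 0 < c & forall x, lin_span e x -> c * hnorm x <= hnorm (L x).
Proof.
move=> L_inj; have [C C0 LC] := lin_span_coef (L \o e).
pose K := C * \sum_(i < n) hnorm (e i).
have K0 : 0 <= K by rewrite mulr_ge0 ?sumr_ge0 // => i _; exact: hnorm_ge0.
exists (1 + K)^-1; first by rewrite invr_gt0 ltr_pwDl.
move=> x ex; have [|c LxE cC] := LC (L x).
  case: ex => c ->; exists c; rewrite linear_sum; apply: eq_bigr => i _.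
  by rewrite linearZ.
have xE : x = \sum_(i < n) c i *: e i.
  apply/eqP; rewrite -subr_eq0; apply/eqP/L_inj.
    rewrite addrC -scaleN1r; apply: lin_span_comb => //; by exists c.
  rewrite linearB LxE linear_sum; apply/eqP; rewrite subr_eq0; apply/eqP.
  by apply: eq_bigr => i _; rewrite linearZ.
rewrite mulrC ler_pdivrMr ?ltr_pwDl // mulrDr mulr1.
suff : hnorm x <= K * hnorm (L x) by have := hnorm_ge0 (L x); lra.
rewrite {1}xE; apply: le_trans (hnorm_sum _) _.
rewrite /K mulrAC mulr_sumr; apply: ler_sum => i _.
by rewrite hnormZ ler_wpM2r ?hnorm_ge0.
Qed.

End FiniteDim.

(** * Norm attainment and strong orthogonality *)

Section OperatorNorm.
Variables (R : realType) (H : hilbertType R).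
Implicit Types (x y z : H) (T S : {linear H -> H}) (A : set H).

Lemma opnorm_on_unit A (f : H -> H) x : bounded_op f -> A x -> hnorm x = 1 ->
  hnorm (f x) <= opnorm_on A f.
Proof.
move=> /bounded_opP[M M0 fM] Ax x1; apply: ub_le_sup; last by exists x.
by exists M => _ [y [_ y1] <-]; apply: le_trans (fM y) _; rewrite y1 mulr1.
Qed.

Lemma opnorm_on_bound A (f : H -> H) (k : R) : 0 <= k ->
  (forall x, hnorm (f x) <= k * hnorm x) -> opnorm_on A f <= k.
Proof.
move=> k0 fk; rewrite /opnorm_on.
have [->|/set0P ne] := eqVneq [set hnorm (f x) | x in unit_sphere A] set0.
  by rewrite sup0.
apply: ge_sup => // _ [x [_ x1] <-].
by apply: le_trans (fk x) _; rewrite x1 mulr1.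
Qed.

Lemma opnorm_on_ge0 A (f : H -> H) : bounded_op f -> 0 <= opnorm_on A f.
Proof.
move=> bf; have [A0|/set0P[x [Ax x1]]] := eqVneq (unit_sphere A) set0.
  by rewrite /opnorm_on A0 image_set0 sup0.
exact: le_trans (hnorm_ge0 _) (opnorm_on_unit bf Ax x1).
Qed.

Lemma hnorm_normalize x : x != 0 -> hnorm ((hnorm x)^-1%:C *: x) = 1.
Proof.
move=> x0; rewrite hnormZr ger0_norm ?invr_ge0 ?hnorm_ge0 // mulVf //.
by apply: contra_neq x0 => /hnorm_eq0.
Qed.

Lemma opnorm_on_le A T x : bounded_op T ->
  (forall (a : R[i]) y, A y -> A (a *: y)) -> A x ->
  hnorm (T x) <= opnorm_on A T * hnorm x.
Proof.
move=> bT AZ Ax; have [->|x0] := eqVneq x 0.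
  by rewrite linear0 hnorm0 mulr0.
have x1 := hnorm_normalize x0.
have := opnorm_on_unit bT (AZ _ _ Ax) x1.
rewrite linearZ hnormZr ger0_norm ?invr_ge0 ?hnorm_ge0 // mulrC.
rewrite ler_pdivrMr // lt_def hnorm_ge0 andbT.
by apply: contra_neq x0 => /hnorm_eq0.
Qed.

Lemma opnorm_le T x : bounded_op T -> hnorm (T x) <= opnorm T * hnorm x.
Proof. by move=> bT; apply: opnorm_on_le. Qed.

Lemma adjoint_opnorm_le T x : bounded_op T ->
  hnorm (adjoint T x) <= opnorm T * hnorm x.
Proof. by move=> bT; apply: adjoint_le => // y; apply: opnorm_le. Qed.

(** The square of |T^* T x - t^2 x| is at most t^4 |x|^2 (1 - 2 + 1) = 0. *)
Lemma norm_attained_eigen T x : bounded_op T ->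
  hnorm (T x) = opnorm T * hnorm x ->
  adjoint T (T x) = (opnorm T ^+ 2)%:C *: x.
Proof.
move=> bT Tx; apply: subr0_eq; apply: hnorm_eq0; apply/eqP.
rewrite -sqrf_eq0 eq_le sqr_ge0 andbT hnormB_sqr rinnerZr.
rewrite rinnerC -rinner_adjoint // rinnerxx hnormZr exprMn.
rewrite real_normK ?num_real //.
have := adjoint_opnorm_le (T x) bT.
rewrite -ler_sqr ?nnegrE ?mulr_ge0 ?hnorm_ge0 ?opnorm_on_ge0 //.
rewrite exprMn Tx exprMn.
move: (opnorm T ^+ 2) => t; rewrite expr2; lra.
Qed.

Lemma norm_attained_ortho T x y : bounded_op T ->
  hnorm (T x) = opnorm T * hnorm x -> rinner x y = 0 -> rinner (T x) (T y) = 0.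
Proof.
move=> bT Tx xy; rewrite rinnerC rinner_adjoint // norm_attained_eigen //.
by rewrite rinnerZr rinnerC xy mulr0.
Qed.

Lemma abs_op_norm_attained T x : bounded_op T -> 0 < opnorm T ->
  hnorm (T x) = opnorm T * hnorm x -> abs_op T x = (opnorm T)%:C *: x.
Proof.
move=> bT t0 Tx; have [P_lin _ P_pos PP] := abs_opP bT.
set P := abs_op T in P_lin P_pos PP *; set t := opnorm T.
have PPx : P (P x) = (t ^+ 2)%:C *: x.
  by rewrite -norm_attained_eigen // -[RHS]/((adjoint T \o T) x) -PP.
pose u := P x - t%:C *: x.
have PB a y z : P (a *: y + z) = a *: P y + P z by exact: P_lin.
have Pu : P u = (- t)%:C *: u.
  rewrite /u addrC -scaleNr PB PPx -rmorphN scalerDr scalerA -rmorphM /=.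
  by rewrite addrC -expr2 sqrrN.
have := P_pos u; rewrite lecE => /andP[_].
rewrite -/(rinner _ _) Pu rinnerZl rinnerxx /=.
rewrite mulNr oppr_ge0 pmulr_rle0 // => u0.
apply: subr0_eq; apply: hnorm_eq0; apply/eqP.
by rewrite -sqrf_eq0 eq_le u0 sqr_ge0.
Qed.

Lemma strong_BJ_orth_of_unit T S x : bounded_op T -> bounded_op S ->
  hnorm x = 1 -> hnorm (T x) = opnorm T -> adjoint S (T x) = 0 ->
  strong_BJ_orth T S.
Proof.
move=> bT bS x1 Tx STx A bA.
have [M M0 TM] := bounded_opP bT; have [N N0 SN] := bounded_opP bS.
have [K K0 AK] := bounded_opP bA.
have bU : bounded_op (T \+ (S \o A)).
  exists (M + N * K) => y /=; apply: le_trans (ler_hnormD _ _) _.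
  rewrite mulrDl lerD // -mulrA; apply: le_trans (SN _) _.
  by rewrite ler_wpM2l.
apply: le_trans (opnorm_on_unit bU I x1).
have [->|t0] := eqVneq (opnorm T) 0; first exact: hnorm_ge0.
have {}t0 : 0 < opnorm T by rewrite lt_def t0 opnorm_on_ge0.
rewrite -(ler_pM2r t0) -{3}Tx; apply: le_trans (rinner_le _ _) => /=.
rewrite rinnerDl (rinner_adjoint bS) STx (rinnerC _ 0) rinner0l addr0.
by rewrite rinnerxx Tx expr2.
Qed.

(** The operator 1 - eps S S^* is a contraction, with a quantitative gain. *)
Lemma perturbation_le S (M eps : R) y : bounded_op S -> 0 <= eps ->
  (forall x, hnorm (S x) <= M * hnorm x) -> eps * M ^+ 2 <= 1 ->
  hnorm (y - eps%:C *: S (adjoint S y)) ^+ 2 <=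
    hnorm y ^+ 2 - eps * hnorm (adjoint S y) ^+ 2.
Proof.
move=> bS eps0 SM epsM.
rewrite hnormB_sqr rinnerZr rinnerC rinner_adjoint // rinnerxx hnormZr exprMn.
rewrite real_normK ?num_real //.
have : hnorm (S (adjoint S y)) ^+ 2 <= M ^+ 2 * hnorm (adjoint S y) ^+ 2.
  rewrite -exprMn ler_sqr ?nnegrE ?hnorm_ge0 //.
  exact: le_trans (hnorm_ge0 _) (SM _).
move: (hnorm (adjoint S y) ^+ 2) (sqr_ge0 (hnorm (adjoint S y))) => q q0 h.
have h1 : eps ^+ 2 * hnorm (S (adjoint S y)) ^+ 2 <= eps ^+ 2 * (M ^+ 2 * q).
  by rewrite ler_wpM2l ?sqr_ge0.
have h2 : eps ^+ 2 * (M ^+ 2 * q) <= eps * q.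
  have -> : eps ^+ 2 * (M ^+ 2 * q) = eps * q * (eps * M ^+ 2) by ring.
  by rewrite ler_piMr // mulr_ge0.
lra.
Qed.

Lemma not_strong_BJ_orth n (e : 'I_n -> H) T S :
  bounded_op T -> bounded_op S ->
  (forall x, lin_span e x -> hnorm (T x) = opnorm T * hnorm x) ->
  opnorm_on (ortho_compl (lin_span e)) T < opnorm T ->
  (forall x, lin_span e x -> adjoint S (T x) = 0 -> x = 0) ->
  ~ strong_BJ_orth T S.
Proof.
move=> bT bS e_max b_lt_t ST_inj BJ.
have Sadj_lin := adjoint_linear bS.
have ST_lin : linear (adjoint S \o T).
  by move=> a x y /=; rewrite linearP Sadj_lin.
have [c c0 cP] := @lin_span_bounded_below _ _ n e (linear_pack ST_lin) ST_inj.
have [M M0 SM] := bounded_opP bS; have SadjM := adjoint_le bS SM.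
set t := opnorm T in e_max b_lt_t *; set b := opnorm_on _ _ in b_lt_t.
have b0 : 0 <= b by exact: opnorm_on_ge0.
have t0 : 0 < t := le_lt_trans b0 b_lt_t.
have bP y : ortho_compl (lin_span e) y -> hnorm (T y) <= b * hnorm y.
  apply: opnorm_on_le => // a {}y oy z ez.
  by rewrite hinnerZl oy // mulr0.
(* small enough for eps M^2 <= 1 and b^2 (1 + eps M^2) <= b t *)
pose eps := (t - b) / (t * (1 + M ^+ 2)).
have k0 : 0 < 1 + M ^+ 2 by rewrite ltr_pwDl ?sqr_ge0.
have eps0 : 0 < eps by rewrite divr_gt0 ?mulr_gt0 // subr_gt0.
have epsE : eps * (t * (1 + M ^+ 2)) = t - b.
  by rewrite divfK // gt_eqF ?mulr_gt0.
clearbody eps.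
have epsM : t * (eps * M ^+ 2) <= t - b.
  by rewrite -epsE; have := mulr_gt0 eps0 t0; lra.
have epsM1 : eps * M ^+ 2 <= 1 by rewrite -(ler_pM2l t0) mulr1; lra.
pose k := Num.max (t ^+ 2 - eps * c ^+ 2 / 2) (b * t).
have k_ge0 : 0 <= k by rewrite le_max mulr_ge0 ?orbT // ltW.
have k_lt : k < t ^+ 2.
  rewrite gt_max expr2 ltr_pM2r // b_lt_t andbT ltrBlDr ltrDl.
  by rewrite divr_gt0 ?mulr_gt0 ?exprn_gt0.
pose f x := (- eps)%:C *: adjoint S (T x).
have f_lin : linear f.
  move=> a x y; rewrite /f linearP Sadj_lin scalerDr !scalerA.
  by rewrite (mulrC a).
have f_bd : bounded_op f.
  exists (eps * (M * t)) => x; rewrite /f hnormZr normrN gtr0_norm // -mulrA.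
  rewrite ler_pM2l // -mulrA; apply: le_trans (SadjM _) _.
  by rewrite ler_wpM2l // opnorm_le.
suff : opnorm (T \+ (S \o f)) <= Num.sqrt k.
  have := BJ (linear_pack f_lin) f_bd => /le_trans /[apply].
  rewrite leNgt -[opnorm T]/t -(gtr0_norm t0) -sqrtr_sqr.
  by rewrite ltr_sqrt ?exprn_gt0 ?k_lt.
apply: opnorm_on_bound => [|z]; first exact: sqrtr_ge0.
rewrite -ler_sqr ?nnegrE ?mulr_ge0 ?sqrtr_ge0 ?hnorm_ge0 // exprMn sqr_sqrtr //.
have [x [y [ex oy zE]]] := lin_span_proj e z.
have xy : rinner x y = 0 by rewrite rinnerC /rinner oy.
have -> : (T \+ (S \o f)) z = T z - eps%:C *: S (adjoint S (T z)).
  by rewrite /= /f linearZ_LR (rmorphN (real_complex R)) scaleNr.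
apply: le_trans (perturbation_le (T z) bS (ltW eps0) SM epsM1) _.
have z2 : hnorm z ^+ 2 = hnorm x ^+ 2 + hnorm y ^+ 2 by rewrite zE ortho_sqr.
have Tz2 : hnorm (T z) ^+ 2 = t ^+ 2 * hnorm x ^+ 2 + hnorm (T y) ^+ 2.
  have Txy := norm_attained_ortho bT (e_max x ex) xy.
  by rewrite zE linearD (ortho_sqr Txy) e_max // exprMn.
have Ty2 : hnorm (T y) ^+ 2 <= b ^+ 2 * hnorm y ^+ 2.
  by rewrite -exprMn ler_sqr ?nnegrE ?mulr_ge0 ?hnorm_ge0 // bP.
have STy2 : hnorm (adjoint S (T y)) ^+ 2 <= M ^+ 2 * hnorm (T y) ^+ 2.
  by rewrite -exprMn ler_sqr ?nnegrE ?mulr_ge0 ?hnorm_ge0.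
have STx2 : c ^+ 2 * hnorm x ^+ 2 <= hnorm (adjoint S (T x)) ^+ 2.
  by rewrite -exprMn ler_sqr ?nnegrE ?mulr_ge0 ?hnorm_ge0 ?(ltW c0) // cP.
(* from |u - v|^2 <= 2 |u|^2 + 2 |v|^2 *)
have STz2 : hnorm (adjoint S (T x)) ^+ 2 <=
    2 * hnorm (adjoint S (T z)) ^+ 2 + 2 * hnorm (adjoint S (T y)) ^+ 2.
  have -> : adjoint S (T x) = adjoint S (T z) - adjoint S (T y).
    have := Sadj_lin 1 (T x) (T y); rewrite !scale1r -linearD -zE => ->.
    by rewrite addrK.
  have := sqr_ge0 (hnorm (adjoint S (T z) + adjoint S (T y))).
  by rewrite hnormB_sqr hnormD_sqr; lra.
have kx : (t ^+ 2 - eps * c ^+ 2 / 2) * hnorm x ^+ 2 <= k * hnorm x ^+ 2.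
  by rewrite ler_wpM2r ?sqr_ge0 // le_max lexx.
have ky : b * t * hnorm y ^+ 2 <= k * hnorm y ^+ 2.
  by rewrite ler_wpM2r ?sqr_ge0 // le_max lexx orbT.
have bb : b ^+ 2 + eps * M ^+ 2 * b ^+ 2 <= b * t.
  rewrite -(ler_pM2r t0).
  have : b ^+ 2 * (t * (eps * M ^+ 2)) <= b ^+ 2 * (t - b).
    by rewrite ler_wpM2l ?sqr_ge0.
  have : 0 <= b * (t - b) ^+ 2 by rewrite mulr_ge0 ?sqr_ge0.
  by lra.
have bby : (b ^+ 2 + eps * M ^+ 2 * b ^+ 2) * hnorm y ^+ 2 <=
    b * t * hnorm y ^+ 2.
  by rewrite ler_wpM2r ?sqr_ge0.
have Ty2M : M ^+ 2 * hnorm (T y) ^+ 2 <= M ^+ 2 * (b ^+ 2 * hnorm y ^+ 2).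
  by rewrite ler_wpM2l ?sqr_ge0.
have q_ge : c ^+ 2 / 2 * hnorm x ^+ 2 - M ^+ 2 * (b ^+ 2 * hnorm y ^+ 2) <=
    hnorm (adjoint S (T z)) ^+ 2 by lra.
have := ler_wpM2l (ltW eps0) q_ge.
rewrite z2 Tz2; lra.
Qed.

End OperatorNorm.

Theorem theorem2p13 (R : realType) (H : hilbertType R)
    (T : {linear H -> H}) (H0 : set H) :
  ~ fin_dim_subspace [set: H] ->
  bounded_op T ->
  fin_dim_subspace H0 ->
  unit_sphere H0 = norm_attaining T ->
  opnorm_on (ortho_compl H0) T < opnorm T ->
  forall S : {linear H -> H}, bounded_op S ->
    [<-> strong_BJ_orth T S;
         exists xi : H, [/\ unit_sphere H0 xi, hnorm (T xi) = opnorm T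
                          & adjoint S (T xi) = 0];
         exists xi : H, [/\ unit_sphere H0 xi,
                            (opnorm T)%:C *: xi = abs_op T xi
                          & adjoint S (T xi) = 0]].
Proof.
move=> _ bT [n [e ->]] M_T b_lt_t S bS.
have t0 : 0 < opnorm T.
  exact: le_lt_trans (opnorm_on_ge0 _ bT) b_lt_t.
have e_max x : lin_span e x -> hnorm (T x) = opnorm T * hnorm x.
  move=> ex; have [->|x0] := eqVneq x 0; first by rewrite linear0 hnorm0 mulr0.
  have : unit_sphere (lin_span e) ((hnorm x)^-1%:C *: x).
    by split; [exact: lin_spanZ | exact: hnorm_normalize].
  rewrite M_T => -[_]; rewrite linearZ hnormZr => <-.
  rewrite ger0_norm ?invr_ge0 ?hnorm_ge0 // mulrAC mulVf ?mul1r //.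
  by apply: contra_neq x0 => /hnorm_eq0.
tfae.
- move=> BJ; apply: contrapT => noxi.
  apply: (not_strong_BJ_orth bT bS e_max b_lt_t _ BJ) => x ex STx.
  apply/eqP/negPn/negP => x0; apply: noxi.
  have ux : unit_sphere (lin_span e) ((hnorm x)^-1%:C *: x).
    by split; [exact: lin_spanZ | exact: hnorm_normalize].
  exists ((hnorm x)^-1%:C *: x); split=> //.
    by move: ux; rewrite M_T => -[].
  pose Sadj := linear_pack (adjoint_linear bS).
  by rewrite linearZ -[adjoint S _]/(Sadj _) linearZ /= STx scaler0.
- move=> [xi [[exi xi1] Txi STxi]]; exists xi; split=> //.
  by rewrite abs_op_norm_attained // e_max.
- move=> [xi [uxi _ STxi]].
  have [xi1 Txi] : norm_attaining T xi by rewrite -M_T.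
  exact: strong_BJ_orth_of_unit bT bS xi1 Txi STxi.
Qed.
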